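(* Let $\gamma\geq 3$ and let $n$ be sufficiently large with respect to $\gamma$. Then there exists an $n\times n$ Boolean matrix $M$ such that $\gamma_2(M)\leq \gamma$, and $M$ contains no $t\times t$ all-zeros or all-ones submatrix for any $t>n2^{-\gamma+3}$.
   Context: A Boolean matrix has all entries in $\{0,1\}$. A submatrix is obtained by selecting any subset of rows and any subset of columns. For a real matrix $M$, $\gamma_2(M)=\min_{U,V:\,M=UV}\|U\|_{\mathrm{row}}\|V\|_{\mathrm{col}}$, where $\|U\|_{\mathrm{row}}$ is the maximum Euclidean norm of a row of $U$ and $\|V\|_{\mathrm{col}}$ is the maximum Euclidean norm of a column of $V$. *)

(* Defs.v *)
From HB Require Import structures.
From mathcomp Require Import all_boot all_order all_algebra.
From mathcomp Require Import all_classical all_reals all_analysis.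

Set Implicit Arguments.
Unset Strict Implicit.
Unset Printing Implicit Defensive.

Import Order.TTheory GRing.Theory Num.Theory.

Local Open Scope classical_set_scope.
Local Open Scope ring_scope.

Definition boolean_mx (R : realType) (m n : nat) (M : 'M[R]_(m, n)) : Prop :=
  forall i j, M i j = 0 \/ M i j = 1.

(* The library norm on matrices is the entrywise sup norm, hence the explicit
   Euclidean norms. *)
Definition row_norm (R : realType) (m n : nat) (U : 'M[R]_(m, n)) : R :=
  \big[Num.max/0]_(i < m) Num.sqrt (\sum_(j < n) U i j ^+ 2).

Definition col_norm (R : realType) (m n : nat) (V : 'M[R]_(m, n)) : R :=
  \big[Num.max/0]_(j < n) Num.sqrt (\sum_(i < m) V i j ^+ 2).

Definition factorization_values (R : realType) (m n : nat) (M : 'M[R]_(m, n)) :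
    set R :=
  [set c | exists (k : nat) (U : 'M[R]_(m, k)) (V : 'M[R]_(k, n)),
             M = U *m V /\ c = row_norm U * col_norm V].

(* The minimum over all factorizations (of every inner dimension), written as an
   infimum so as to be a total function; the infimum is attained. *)
Definition gamma2 (R : realType) (m n : nat) (M : 'M[R]_(m, n)) : R :=
  inf (factorization_values M).

Lemma row_norm_ge0 (R : realType) (m n : nat) (U : 'M[R]_(m, n)) :
  0 <= row_norm U.
Proof. exact: bigmax_ge_id. Qed.

Lemma col_norm_ge0 (R : realType) (m n : nat) (V : 'M[R]_(m, n)) :
  0 <= col_norm V.
Proof. exact: bigmax_ge_id. Qed.

(* [inf] is therefore the genuine greatest lower bound in [gamma2]. *)
Lemma has_inf_factorization_values (R : realType) (m n : nat)
    (M : 'M[R]_(m, n)) : has_inf (factorization_values M).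
Proof.
split; first by exists (row_norm M * col_norm (1%:M : 'M[R]_n)), n, M, 1%:M;
  rewrite mulmx1.
by exists 0 => _ [k [U [V [_ ->]]]]; rewrite mulr_ge0 ?row_norm_ge0 ?col_norm_ge0.
Qed.

Definition submatrix (R : realType) (m n : nat) (A : {set 'I_m})
    (B : {set 'I_n}) (M : 'M[R]_(m, n)) : 'M[R]_(#|A|, #|B|) :=
  mxsub (fun i : 'I_#|A| => enum_val i) (fun j : 'I_#|B| => enum_val j) M.

Definition has_const_submatrix (R : realType) (m n : nat) (M : 'M[R]_(m, n))
    (t : nat) (c : R) : Prop :=
  exists (A : {set 'I_m}) (B : {set 'I_n}),
    [/\ #|A| = t, #|B| = t & submatrix A B M = const_mx c].

(* Main.v *)
(* Give every row i and every column j a word f i, g j of length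
   k = floor(gamma) over an alphabet of size N, and let M i j count the
   coordinates in which f i and g j agree.  The inner products of the indicator
   vectors of the pairs (c, f i c) and (c, g j c) give gamma2 M <= k, and M is
   Boolean as soon as no f i and g j agree twice.

   In an all-zeros submatrix the letters used by the rows and by the columns are
   disjoint in every coordinate, so the rows and the columns lie in two
   combinatorial boxes, one of which has density at most 2^-k.  In an all-ones
   submatrix the columns lie in the star of any of the rows, the set of words
   agreeing with it somewhere, whose density is at most k/N.  There are at most
   2^(kN+1) boxes and stars, so if N is a small constant times n, random words put
   at most about 4n/2^k samples in every box and star of density at most 2^-k
   (exponential moments).  Choosing f first, at most half of all words agree
   twice with some f i, and g is sampled from the other half. *)
Require Import Defs.
From mathcomp Require Import all_boot all_order all_algebra.
From mathcomp Require Import all_classical all_reals all_analysis.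
From mathcomp Require Import fintype finset zify lra.
Import Order.TTheory GRing.Theory Num.Theory.

(** * Sampling by exponential moments *)

(** Bernoulli's inequality [(1 - 1/(q+1))^h >= 1 - h/(q+1)], cleared of denominators. *)
Lemma bernoulli_natB (q h : nat) : h <= q.+1 ->
  q.+1 ^ h * (q.+1 - h) <= q ^ h * q.+1.
Proof.
elim: h => [|h IHh] hq; first by rewrite subn0 !expn0.
have {}IHh := IHh (ltnW hq).
have step : q.+1 * (q.+1 - h.+1) <= q * (q.+1 - h) by nia.
rewrite !expnS; have := leq_mul (leqnn (q.+1 ^ h)) step.
by have := leq_mul (leqnn q) IHh; nia.
Qed.

(** Bernoulli at [q = 4h] gives [(1 + 1/(4h))^h <= 4/3]. The power [2m] of this bounds
    [(1 + 1/(4h))^n] by [(16/9)^m]. *)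
Lemma growth_bound (h n m : nat) : 0 < h -> n <= m * 2 * h ->
  (4 * h).+1 ^ n * 9 ^ m <= 16 ^ m * (4 * h) ^ n.
Proof.
move=> h0 hn; set P := 4 * h.
have key : 3 * P.+1 ^ h <= 4 * P ^ h.
  have hP : h <= P.+1 by rewrite /P; lia.
  have := bernoulli_natB P h hP; rewrite /P; nia.
have full : P.+1 ^ (m * 2 * h) * 9 ^ m <= 16 ^ m * P ^ (m * 2 * h).
  have : (3 * P.+1 ^ h) ^ (2 * m) <= (4 * P ^ h) ^ (2 * m).
    by case: m {hn} => [|m]; rewrite ?muln0 // leq_exp2r.
  rewrite !expnMn (expnM 3) (expnM 4) -!expnM mulnC.
  by rewrite [h * (2 * m)]mulnC [2 * m]mulnC.
have P0 : 0 < P by rewrite muln_gt0 h0.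
rewrite -(leq_pmul2r (m := P ^ (m * 2 * h - n))) ?expn_gt0 ?P0 //.
apply: leq_trans (_ : P.+1 ^ (m * 2 * h) * 9 ^ m <= _).
  rewrite mulnAC leq_mul2r; apply/orP; right.
  rewrite -[in leqRHS](subnKC hn) expnD leq_mul2l; apply/orP; right.
  by case: (_ - _) => // d; rewrite leq_exp2r.
by rewrite -(mulnA (16 ^ m)) -expnD subnKC.
Qed.

(** For [g] uniform in [Y^n], the mean of [2^(hits of D)] is [(1 + |Y :&: D|/|Y|)^n]. If every [g]
    hit some [D] at least [m] times, these means would sum over [F] to at least [2^m]. *)
Lemma exists_sparse_sample (X : finType) (n m : nat) (Y : {set X})
    (F : {set {set X}}) :
  \sum_(D in F) (#|Y| + #|Y :&: D|) ^ n < 2 ^ m * #|Y| ^ n ->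
  exists g : {ffun 'I_n -> X},
    (forall i, g i \in Y) /\ (forall D, D \in F -> #|[set i | g i \in D]| < m).
Proof.
move=> hF.
case: (pickP [pred g : {ffun 'I_n -> X} | (g \in ffun_on (mem Y)) &&
    [forall D in F, #|[set i | g i \in D]| < m]])
  => [g /andP[/ffun_onP gY gD]|H].
  by exists g; split=> // D DF; apply: (implyP (forallP gD D)).
suff : 2 ^ m * #|Y| ^ n <= \sum_(D in F) (#|Y| + #|Y :&: D|) ^ n.
  by rewrite leqNgt hF.
(* The sum over g of 2 ^ #|[set i | g i \in D]| factors over i. *)
pose w (D : {set X}) (x : X) := 1 + (x \in D).
have wE D : (#|Y| + #|Y :&: D|) ^ n =
    \sum_(g : {ffun 'I_n -> X} | g \in ffun_on (mem Y)) \prod_(i < n) w D (g i).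
  rewrite -(bigA_distr_big (mem Y) (fun (i : 'I_n) x => w D x)).
  rewrite prod_nat_const card_ord big_split /= sum1_card.
  congr ((_ + _) ^ _); rewrite -sum1_card big_mkcond [RHS]big_mkcond /=.
  by apply: eq_bigr => x _; rewrite inE; do 2 case: (x \in _).
rewrite (eq_bigr _ (fun D _ => wE D)) exchange_big /=.
have -> : 2 ^ m * #|Y| ^ n =
    \sum_(g : {ffun 'I_n -> X} | g \in ffun_on (mem Y)) 2 ^ m.
  by rewrite sum_nat_const card_ffun_on card_ord mulnC.
apply: leq_sum => g gY; have := H g; rewrite inE gY => /negbT.
rewrite negb_forall => /existsP[D]; rewrite negb_imply -leqNgt => /andP[DF mD].
rewrite (bigD1 D) //=; apply: leq_trans (leq_addr _ _).
apply: leq_trans (_ : 2 ^ #|[set i | g i \in D]| <= _).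
  by rewrite leq_exp2l.
rewrite -prod_nat_const big_mkcond leq_prod // => i _.
by rewrite inE /w; case: (g i \in D).
Qed.

(** Each [D] has moment at most [(16/9)^m] by [growth_bound], and fewer than [(9/8)^m] sets [D]
    occur; the product of the two bounds is [2^m]. *)
Lemma exists_sample_of_density (X : finType) (h n m : nat) (Y : {set X})
    (F : {set {set X}}) :
  0 < h -> n <= m * 2 * h -> 0 < #|Y| ->
  (forall D, D \in F -> 4 * h * #|D| <= #|Y|) -> #|F| * 8 ^ m < 9 ^ m ->
  exists g : {ffun 'I_n -> X},
    (forall i, g i \in Y) /\ (forall D, D \in F -> #|[set i | g i \in D]| < m).
Proof.
move=> h0 hn Y0 hD hF; apply: exists_sparse_sample.
set P := 4 * h.
have P0 : 0 < P ^ n * 9 ^ m by rewrite muln_gt0 !expn_gt0 muln_gt0 h0.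
rewrite -(ltn_pmul2r P0).
apply: (@leq_ltn_trans (#|F| * (16 ^ m * P ^ n * #|Y| ^ n))).
  rewrite big_distrl /= -sum_nat_const; apply: leq_sum => D DF.
  apply: leq_trans (_ : (P.+1 * #|Y|) ^ n * 9 ^ m <= _).
    rewrite mulnA -expnMn leq_mul2r; apply/orP; right.
    case: (n) => [|n'] //; rewrite leq_exp2r // mulnDl.
    have := hD D DF; rewrite -/P; have := subset_leq_card (subsetIr Y D); nia.
  rewrite expnMn mulnAC leq_mul2r; apply/orP; right; exact: growth_bound.
have E : 16 ^ m = 8 ^ m * 2 ^ m by rewrite -expnMn.
have PY : 0 < P ^ n * #|Y| ^ n * 2 ^ m.
  by rewrite !muln_gt0 !expn_gt0 muln_gt0 h0 Y0.
move: hF; rewrite -(ltn_pmul2r PY) E.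
by move: (8 ^ m) (9 ^ m) (2 ^ m) (P ^ n) (#|Y| ^ n) => a b c d e; nia.
Qed.

(** * Counting words in boxes and stars *)

Lemma card_le_sum_cover (T I : finType) (A : {set T}) (P : pred I)
    (B : I -> {set T}) :
  (forall x, x \in A -> exists2 i, P i & x \in B i) ->
  #|A| <= \sum_(i | P i) #|B i|.
Proof.
move=> H; under eq_bigr => i _ do rewrite -sum1_card big_mkcond /=.
rewrite exchange_big /= -sum1_card big_mkcond /= leq_sum // => x _.
case: ifP => // /H[i Pi xB]; rewrite (bigD1 i) //= xB; exact: leq_addr.
Qed.

Definition box {k N : nat} (S : {ffun 'I_k -> {set 'I_N}}) :
    {set {ffun 'I_k -> 'I_N}} :=
  [set x : {ffun 'I_k -> 'I_N} | [forall c, x c \in S c]].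

Definition agreement {k N : nat} (x y : {ffun 'I_k -> 'I_N}) : {set 'I_k} :=
  [set c | x c == y c].

Definition star {k N : nat} (x : {ffun 'I_k -> 'I_N}) :
    {set {ffun 'I_k -> 'I_N}} :=
  [set y | agreement x y != set0].

Lemma card_box (k N : nat) (S : {ffun 'I_k -> {set 'I_N}}) :
  #|box S| = \prod_(c < k) #|S c|.
Proof.
transitivity #|family (fun c => mem (S c))|.
  by apply: eq_card => x; rewrite inE; apply/forallP/familyP.
by rewrite card_family foldrE big_map big_enum.
Qed.

(** These words form a box with singleton sides on [J] and full sides elsewhere. *)
Lemma card_agree_on (k N : nat) (J : {set 'I_k}) (x : {ffun 'I_k -> 'I_N}) :
  #|[set y | J \subset agreement x y]| * N ^ #|J| = N ^ k.
Proof.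
pose S := [ffun c => if c \in J then [set x c] else setT].
have -> : [set y | J \subset agreement x y] = box S.
  apply/setP => y; rewrite !inE; apply/subsetP/forallP => [H c|H c cJ].
    by rewrite ffunE; case: ifP => // /H; rewrite !inE eq_sym.
  by have := H c; rewrite ffunE cJ !inE eq_sym.
rewrite card_box -prod_nat_const [in X in _ * X]big_mkcond -big_split /=.
rewrite (eq_bigr (fun=> N)) ?prod_nat_const ?card_ord // => c _.
by rewrite ffunE; case: ifP; rewrite ?cards1 ?mul1n // cardsT card_ord muln1.
Qed.

(** By AM-GM, disjointness gives [4 |S c| |T c| <= N^2], so the two densities have product at most
    [4^-k]. *)
Lemma small_box_of_disjoint (k N : nat) (S T : {ffun 'I_k -> {set 'I_N}}) :
  (forall c, [disjoint S c & T c]) ->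
  (2 ^ k * #|box S| <= N ^ k) || (2 ^ k * #|box T| <= N ^ k).
Proof.
move=> dST; have H : (2 ^ k * #|box S|) * (2 ^ k * #|box T|) <= N ^ k * N ^ k.
  have E a : a ^ k = \prod_(c < k) a by rewrite prod_nat_const card_ord.
  rewrite !card_box !E -!big_split /=; apply: leq_prod => c _.
  have [_] := leq_card_setU (S c) (T c); rewrite dST => /eqP E2.
  have := max_card (mem (S c :|: T c)); rewrite E2 card_ord => H.
  have := leq_mul H H.
  rewrite mulnn => /(leq_trans (nat_AGM2 _ _)).
  by rewrite mulnACA.
apply: contraLR H; rewrite negb_or -!ltnNge => /andP[]; exact: ltn_mul.
Qed.

Lemma card_star (k N : nat) (x : {ffun 'I_k -> 'I_N}) :
  #|star x| * N <= k * N ^ k.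
Proof.
pose B c := [set y | [set c] \subset agreement x y].
have /(leq_mul (leqnn N)) : #|star x| <= \sum_(c < k | true) #|B c|.
  apply: card_le_sum_cover => y; rewrite inE => /set0Pn[c cA].
  by exists c => //; rewrite inE sub1set.
rewrite mulnC big_distrr /= => /leq_trans; apply.
rewrite (eq_bigr (fun=> N ^ k)) ?sum_nat_const ?card_ord // => c _.
by rewrite -(card_agree_on k N [set c] x) cards1 expn1 mulnC.
Qed.

(** Union bound over [i] and pairs of distinct coordinates: agreement with [f i] on a given pair has
    density [N^-2]. *)
Lemma card_multiple_agreement (k N n : nat)
    (f : {ffun 'I_n -> {ffun 'I_k -> 'I_N}}) :
  #|[set y | [exists i, 1 < #|agreement (f i) y|]]| * N ^ 2 <=
    n * k ^ 2 * N ^ k.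
Proof.
set A := [set y | _].
pose B (p : 'I_n * ('I_k * 'I_k)) :=
  [set y | [set p.2.1; p.2.2] \subset agreement (f p.1) y].
have /(leq_mul (leqnn (N ^ 2))) : #|A| <= \sum_(p | p.2.1 != p.2.2) #|B p|.
  apply: card_le_sum_cover => y; rewrite inE => /existsP[i].
  case/card_gt1P => a [b [aA bA ab]].
  by exists (i, (a, b)) => //; rewrite inE subUset !sub1set aA.
rewrite mulnC big_distrr /= => /leq_trans; apply.
rewrite (eq_bigr (fun=> N ^ k)) ?sum_nat_const; last first.
  move=> p pp; rewrite -(card_agree_on k N [set p.2.1; p.2.2] (f p.1)).
  by rewrite cards2 pp mulnC.
rewrite leq_mul2r; apply/orP; right; apply: leq_trans (max_card _) _.
by rewrite !card_prod !card_ord mulnn.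
Qed.

(** * Choice of the words and of the parameters *)

(** The hypotheses on [N] and [m] serve, in order, to keep half of all words free of double
    agreements, to make stars small, to fit the moment bound, and to control the number of tests. *)
Lemma exists_sparse_families (k N n m : nat) :
  2 < k -> 2 * n * k ^ 2 <= N ^ 2 -> k * 2 ^ k <= N ->
  4 * n < m * 2 ^ k -> 6 * (k * N).+1 <= m ->
  exists f g : {ffun 'I_n -> {ffun 'I_k -> 'I_N}},
    (forall i j, #|agreement (f i) (g j)| <= 1) /\
    forall A B : {set 'I_n}, m <= #|A| -> m <= #|B| ->
      (exists i j, [/\ i \in A, j \in B & agreement (f i) (g j) != set0]) /\
      (exists i j, [/\ i \in A, j \in B & agreement (f i) (g j) = set0]).
Proof.
move=> k2 nN kN nm Nm.
have N0 : 0 < N.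
  by apply: leq_trans kN; rewrite muln_gt0 expn_gt0 (ltn_trans _ k2).
pose X : finType := {ffun 'I_k -> 'I_N}.
have cX : #|{: X}| = N ^ k by rewrite card_ffun !card_ord.
pose small (D : {set X}) := 2 ^ k * #|D| <= N ^ k.
pose tests : {set {set X}} :=
  [set box S | S : {ffun 'I_k -> {set 'I_N}}] :|: [set star x | x : X].
pose F := [set D in tests | small D].
have boxF S : small (box S) -> box S \in F.
  by rewrite inE inE imset_f //= => ->.
have starF x : star x \in F.
  rewrite inE inE imset_f ?orbT //= /small -(leq_pmul2r N0).
  rewrite -mulnA; apply: leq_trans (leq_mul (leqnn _) (card_star _ _ x)) _.
  by rewrite mulnCA mulnA mulnC leq_mul2l kN orbT.
have cF : #|F| * 8 ^ m < 9 ^ m.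
  set q := (k * N).+1 in Nm.
  have FN : #|F| <= 2 ^ q.
    apply: leq_trans (_ : #|tests| <= _).
      by apply: subset_leq_card; apply/subsetP => D; rewrite inE => /andP[].
    apply: leq_trans (leq_card_setU _ _) _.
    rewrite expnS mul2n -addnn leq_add //;
      apply: leq_trans (leq_imset_card _ _) _.
      rewrite card_ffun card_ord.
      have -> : #|{: {set 'I_N}}| = 2 ^ N.
        by rewrite -cardsT -powersetT card_powerset cardsT card_ord.
      by rewrite -expnM mulnC.
    rewrite cX mulnC expnM; case: (k) => // k'; rewrite leq_exp2r //.
    exact/ltnW/ltn_expl.
  rewrite -(subnKC Nm) !expnD mulnA.
  apply: leq_trans (_ : 9 ^ (6 * q) * 8 ^ (m - 6 * q) <= _).
    rewrite ltn_pmul2r ?expn_gt0 //.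
    apply: leq_ltn_trans (leq_mul FN (leqnn _)) _.
    (* The factor 6 in the hypothesis on [m] comes from [2 < (9/8)^6]. *)
    have num : 2 * 8 ^ 6 < 9 ^ 6 by rewrite !expnS !expn0; lia.
    rewrite [X in _ < X](expnM _ 6) [X in _ * X](expnM _ 6) -expnMn.
    by rewrite ltn_exp2r; [exact: num|].
  rewrite leq_mul2l; apply/orP; right.
  by case: (m - _) => // d; rewrite leq_exp2r.
(* Density [2^-k = 1/(8h)] among all words becomes at most [1/(4h)] inside a [Y] that holds at least
   half of them. *)
pose h := 2 ^ (k - 3).
have hk : 2 ^ k = 8 * h by rewrite /h -(expnD 2 3) subnKC.
have h0 : 0 < h by rewrite expn_gt0.
have nh : n <= m * 2 * h by move: nm; rewrite hk; nia.
have sample (Y : {set X}) : N ^ k <= 2 * #|Y| ->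
    exists g : {ffun 'I_n -> X},
    (forall i, g i \in Y) /\ (forall D, D \in F -> #|[set i | g i \in D]| < m).
  move=> hY; apply: (exists_sample_of_density _ _ _ _ _ _ h0 nh) => //.
    have : 0 < N ^ k by rewrite expn_gt0 N0.
    by move: hY; lia.
  move=> D; rewrite inE => /andP[_]; rewrite /small hk; move: hY; nia.
have [|f [_ fF]] := sample setT; first by rewrite cardsT cX; lia.
pose Z := [set y | [exists i, 1 < #|agreement (f i) y|]].
pose Y := ~: Z.
have [|g [gY gF]] := sample Y.
  have := card_multiple_agreement k N n f; have := cardsC Z.
  rewrite cX -/Z -/Y; set a := #|_|; set b := #|_| => <- ab.
  have : (2 * a) * N ^ 2 <= (a + b) * N ^ 2 by nia.
  rewrite leq_pmul2r ?expn_gt0 ?N0 //; lia.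
exists f, g; split=> [i j|A B mA mB].
  by have := gY j; rewrite !inE negb_exists => /forallP/(_ i); rewrite -leqNgt.
split.
  case: (pickP [pred p : 'I_n * 'I_n |
      [&& p.1 \in A, p.2 \in B & agreement (f p.1) (g p.2) != set0]]).
    by move=> [i j] /and3P[/= *]; exists i, j.
  move=> H; exfalso.
  pose S := [ffun c => [set f i c | i in A]].
  pose T := [ffun c => [set g j c | j in B]].
  (* A letter common to both sides at [c] would be an agreement of some [f i] and [g j], against
     [H]. *)
  have dST c : [disjoint S c & T c].
    rewrite -setI_eq0; apply/set0Pn => -[v]; rewrite !ffunE inE.
    case/andP => /imsetP[i iA ->] /imsetP[j jB fg].
    have := H (i, j); rewrite /= iA jB /=.
    by move/negbFE/eqP/setP/(_ c); rewrite !inE fg eqxx.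
  have /orP[/boxF/fF|/boxF/gF] := small_box_of_disjoint _ _ _ _ dST;
    apply/negP; rewrite -leqNgt.
    apply: leq_trans mA (subset_leq_card _); apply/subsetP => i iA.
    rewrite !inE; by apply/forallP => c; rewrite ffunE; apply/imsetP; exists i.
  apply: leq_trans mB (subset_leq_card _); apply/subsetP => i iA.
  rewrite !inE; by apply/forallP => c; rewrite ffunE; apply/imsetP; exists i.
have /card_gt0P[i iA] : 0 < #|A| by lia.
have : ~~ (B \subset [set j | g j \in star (f i)]).
  apply/negP => /subset_leq_card; rewrite leqNgt => /negP; apply.
  exact: leq_trans (gF _ (starF (f i))) mB.
case/subsetPn => j jB; rewrite !inE negbK => /eqP E; by exists i, j.
Qed.

(** Here [m] is the least integer above [4n/2^k]. The choice [L = 12 k 2^k] makes [6kN] at most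
    [n/(2 * 2^k)], and [n0] forces [N >= 4 k^2 L], so that [N^2] dominates [2 n k^2] through
    [n <= 2NL]. *)
Lemma exists_parameters (k : nat) : 2 < k -> exists n0, forall n, n0 <= n ->
  exists N m, [/\ 2 * n * k ^ 2 <= N ^ 2, k * 2 ^ k <= N, 4 * n < m * 2 ^ k,
    6 * (k * N).+1 <= m & m.-1 * 2 ^ k <= 4 * n].
Proof.
move=> k2; set P := 2 ^ k; have P0 : 0 < P by rewrite expn_gt0.
pose L := 12 * k * P; have L0 : 0 < L by rewrite /L !muln_gt0 P0; lia.
exists (4 * k ^ 2 * L * L) => n hn; exists (n %/ L), (4 * n %/ P).+1.
set N := n %/ L.
have NL : N * L <= n by exact: leq_trunc_div.
have nN : n < N.+1 * L by exact: ltn_ceil.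
have bigN : 4 * k ^ 2 * L <= N by rewrite leq_divRL.
have mP : 4 * n < (4 * n %/ P).+1 * P by exact: ltn_ceil.
have k20 : 0 < k ^ 2 by rewrite expn_gt0; lia.
have LN : L <= N by nia.
split=> //=; last exact: leq_trunc_div.
- have n2 : n <= 2 * N * L by nia.
  apply: (leq_trans (_ : _ <= N * (4 * k ^ 2 * L))); first by nia.
  by rewrite -mulnn leq_mul2l bigN orbT.
- by apply: leq_trans LN; rewrite /L; nia.
- have P6 : 6 * P <= n.
    apply: leq_trans NL; apply: (leq_trans (_ : _ <= N)); last by nia.
    by move: LN; rewrite /L; nia.
  rewrite -(leq_pmul2r P0); apply: ltnW; apply: leq_ltn_trans mP.
  by move: NL; rewrite /L; nia.
Qed.

(** * The factorization bound and the final matrix *)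

Local Open Scope ring_scope.

Lemma sum_indicator (R : nzRingType) (N : nat) (v : 'I_N) (G : 'I_N -> R) :
  \sum_w (v == w)%:R * G w = G v.
Proof.
rewrite (bigD1 v) //= eqxx mul1r big1 ?addr0 // => w.
by rewrite eq_sym => /negPf->; rewrite mul0r.
Qed.

Lemma gamma2_agreement (R : realType) (k N m n : nat)
    (f : 'I_m -> {ffun 'I_k -> 'I_N}) (g : 'I_n -> {ffun 'I_k -> 'I_N}) :
  gamma2 (\matrix_(i, j) #|agreement (f i) (g j)|%:R : 'M[R]_(m, n)) <= k%:R.
Proof.
pose K := #|{: 'I_k * 'I_N}|.
pose ind (x : {ffun 'I_k -> 'I_N}) (p : 'I_K) : R :=
  (x (enum_val p).1 == (enum_val p).2)%:R.
have dot x y : \sum_p ind x p * ind y p = #|agreement x y|%:R.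
  rewrite -(big_enum_val (fun q : 'I_k * 'I_N =>
    (x q.1 == q.2)%:R * (y q.1 == q.2)%:R)).
  rewrite -(pair_bigA _ (fun c v => (x c == v)%:R * (y c == v)%:R)) /=.
  under eq_bigr => c _ do rewrite sum_indicator eq_sym.
  rewrite -natr_sum -sum1_card [in RHS]big_mkcond; congr _%:R.
  by apply: eq_bigr => c _; rewrite inE; case: eqP.
(* A squared norm is the inner product of [ind x] with itself, hence an agreement count, at most
   [k]. *)
have norm x : Num.sqrt (\sum_p ind x p ^+ 2) <= Num.sqrt k%:R.
  under eq_bigr => p _ do rewrite expr2.
  rewrite dot ler_sqrt ?ler0n // ler_nat.
  by apply: leq_trans (max_card _) _; rewrite card_ord.
pose U : 'M[R]_(m, K) := \matrix_(i, p) ind (f i) p.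
pose V : 'M[R]_(K, n) := \matrix_(p, j) ind (g j) p.
have nU : row_norm U <= Num.sqrt k%:R.
  apply: bigmax_le => [|i _]; first exact: sqrtr_ge0.
  by under eq_bigr => p _ do rewrite mxE; exact: norm.
have nV : col_norm V <= Num.sqrt k%:R.
  apply: bigmax_le => [|j _]; first exact: sqrtr_ge0.
  by under eq_bigr => p _ do rewrite mxE; exact: norm.
apply: le_trans (_ : row_norm U * col_norm V <= _).
  apply: ge_inf.
    by have [] := has_inf_factorization_values
      (\matrix_(i, j) #|agreement (f i) (g j)|%:R : 'M[R]_(m, n)).
  exists K, U, V; split=> //; apply/matrixP => i j; rewrite !mxE -dot.
  by apply: eq_bigr => p _; rewrite !mxE.
rewrite -[leRHS](@sqr_sqrtr _ k%:R) // expr2.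
by apply: ler_pM => //; [exact: row_norm_ge0 | exact: col_norm_ge0].
Qed.

Theorem theorem1p4 (R : realType) (gamma : R) (hgamma : 3 <= gamma) :
  exists n0 : nat, forall n : nat, (n0 <= n)%N ->
    exists M : 'M[R]_n,
      [/\ boolean_mx M,
          gamma2 M <= gamma &
          forall t : nat, n%:R * 2 `^ (- gamma + 3) < t%:R ->
            ~ has_const_submatrix M t 0 /\ ~ has_const_submatrix M t 1].
Proof.
pose k := Num.truncn gamma.
have /andP[kg gk] : k%:R <= gamma < k.+1%:R by apply: truncn_itv; lra.
have k2 : (2 < k)%N.
  by rewrite -ltnS -(ltr_nat R); apply: le_lt_trans gk.
have [n0 hn0] := exists_parameters k k2.
exists n0 => n /hn0[N [m [h1 h2 h3 h4 h5]]].
have [f [g [fg1 fgm]]] := exists_sparse_families k N n m k2 h1 h2 h3 h4.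
exists (\matrix_(i, j) #|agreement (f i) (g j)|%:R); split.
- move=> i j; rewrite mxE; have := fg1 i j.
  by case: #|_| => [|[|]]; [left|right|].
- exact: le_trans (gamma2_agreement _ _ _ _ _ f g) kg.
move=> t ht.
(* Since [gamma < k + 1], the exponent [2 - k] is at most [3 - gamma], so [m - 1 <= 4n/2^k] lies
   below [t]. Rounding [gamma] down thus costs at most one factor of 2. *)
have {ht} mt : (m <= t)%N.
  have : (m.-1 < t)%N; last by lia.
  rewrite -(@ltn_pmul2r (2 ^ k)) ?expn_gt0 //; apply: leq_ltn_trans h5 _.
  rewrite -(ltr_nat R) !natrM natrX.
  apply: le_lt_trans (_ : n%:R * 2 `^ (- gamma + 3) * 2 ^+ k < _); last first.
    by rewrite ltr_pM2r // exprn_gt0.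
  rewrite -mulrA mulrC ler_wpM2l //.
  rewrite -powR_mulrn // -powRD; last by rewrite pnatr_eq0 implybT.
  have -> : 4 = 2 `^ 2 :> R.
    by rewrite -[X in _ `^ X]/(2%:R) powR_mulrn // -natrX.
  by apply: ler_powR; rewrite ?ler1n //; move: gk; rewrite -natr1; lra.
(* A constant submatrix fixes the agreement count on all of [A] times [B]; [fgm] supplies a nonzero
   count against the value 0 and a zero count against the value 1. *)
have entry A B c i j : submatrix A B
      (\matrix_(i, j) #|agreement (f i) (g j)|%:R : 'M[R]_n) = const_mx c ->
    i \in A -> j \in B -> #|agreement (f i) (g j)|%:R = c.
  move=> /matrixP H iA jB; have := H (enum_rank_in iA i) (enum_rank_in jB j).
  by rewrite !mxE !enum_rankK_in.
split=> -[A [B [cA cB H]]]; have := fgm A B; rewrite cA cB => /(_ mt mt)[].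
  move=> [i [j [iA jB]]] + _; rewrite -card_gt0 lt0n => /negP; apply.
  by have /eqP := entry A B _ i j H iA jB; rewrite pnatr_eq0.
move=> _ [i [j [iA jB E]]]; have := entry A B _ i j H iA jB.
by rewrite E cards0 => /eqP; rewrite eq_sym oner_eq0.
Qed.
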